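(* Let $a,b,q$ be complex numbers with $|q|<1$ and $b\neq -q^{-N}$ for any positive integer $N$. Then $$\sum_{n=0}^{\infty}\frac{(-a;q)_n\,b^n q^{n(n+1)/2}}{(q;q)_n}=(-bq;q)_{\infty}\sum_{n=0}^{\infty}\frac{(ab)^n q^{n^2}}{(q;q)_n\,(-bq;q)_n}.$$
   Context: Notation: $(x;q)_0=1$, $(x;q)_n=\prod_{j=0}^{n-1}(1-xq^{j})$ for $n\ge 1$, and $(x;q)_\infty=\prod_{j=0}^{\infty}(1-xq^{j})$. The condition $b\ne -q^{-N}$ means $1+bq^N\neq 0$. *)

(* Defs.v *)
(* Stdlib reals, with Coquelicot's complex numbers and series. *)
From Stdlib Require Import Reals.
From Coquelicot Require Import Coquelicot.

Open Scope C_scope.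

(** [qpoch x q n] is the q-shifted factorial
    (x;q)_n = (1 - x) (1 - x q) ... (1 - x q^(n-1)). *)
Fixpoint qpoch (x q : C) (n : nat) : C :=
  match n with
  | O => 1
  | S m => qpoch x q m * (1 - x * q ^ m)
  end.

(** [is_qpoch_inf x q p]: the partial products (x;q)_n converge to p, that is,
    (x;q)_oo = p.  A zero limit is allowed. *)
Definition is_qpoch_inf (x q p : C) : Prop :=
  filterlim (qpoch x q) eventually (locally p).

(* Main.v *)
(** Gaussian binomials [N, n] satisfy [N+1, n+1] = q^(n+1) [N, n+1] + [N, n], tend to 1/(q;q)_n
    as N -> oo and are bounded by (1 - |q|)^(-n).  Pascal's rule and induction on N prove the
    finite identity
      sum_n [N, n] (-a;q)_n b^n q^(n(n+1)/2)
        = sum_k [N, k] (ab)^k q^(k^2) (-b q^(k+1);q)_(N-k),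
    because both sides satisfy F_(N+1)(a, b) = F_N(a, bq) + bq (1 + a) F_N(aq, bq).  The last factor
    is (-bq;q)_N / (-bq;q)_k, and letting N -> oo under the sums (Tannery) gives the claim. *)
Require Import Defs.
From Stdlib Require Import Reals Lra Lia.
From Coquelicot Require Import Coquelicot.
Open Scope C_scope.

(** Coquelicot's sums live in the carrier of an abstract monoid, where [ring] does not recognise [C]. *)
Ltac to_C :=
  change plus with Cplus; match goal with |- ?x = ?y => change (@eq C x y) end.

(** * Gaussian binomials and Pascal's rule *)

Fixpoint gauss (q : C) (N n : nat) : C :=
  match N, n with
  | _, O => 1
  | O, S _ => 0
  | S M, S m => q ^ n * gauss q M n + gauss q M m
  end.

Lemma gauss_0_r q N : gauss q N 0 = 1.
Proof. now destruct N. Qed.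

Lemma gauss_gt q N n : (N < n)%nat -> gauss q N n = 0.
Proof.
  revert n; induction N as [|N IH]; intros [|n] H; try lia; simpl; auto.
  rewrite !IH by lia. ring.
Qed.

(** A division-free form of the product formula for Gaussian binomials. It fixes their limit in [N],
    since it relates column [S n] to column [n]. *)
Lemma gauss_absorb q N n :
  gauss q (S N) (S n) * (1 - q ^ S n) = (1 - q ^ S N) * gauss q N n.
Proof.
  revert n; induction N as [|N IH]; intros n.
  - destruct n as [|n]; simpl; ring.
  - change (gauss q (S (S N)) (S n))
      with (q ^ S n * gauss q (S N) (S n) + gauss q (S N) n).
    transitivity (q ^ S n * (gauss q (S N) (S n) * (1 - q ^ S n))
                  + (1 - q ^ S n) * gauss q (S N) n); [ring|].
    rewrite IH.
    destruct n as [|n].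
    + rewrite !gauss_0_r. rewrite !Cpow_S. simpl (q ^ 0). ring.
    (* The induction hypothesis serves twice, at [S n] and at [n]; Pascal's rule in between
       eliminates [gauss q N (S n)]. *)
    + specialize (IH n).
      assert (E : q ^ S n * gauss q N (S n) = gauss q (S N) (S n) - gauss q N n)
        by (simpl; ring).
      transitivity (q * (1 - q ^ S N) * (q ^ S n * gauss q N (S n))
                    + (1 - q ^ S (S n)) * gauss q (S N) (S n)).
      { rewrite (Cpow_S q (S n)). ring. }
      rewrite E.
      transitivity (q * (1 - q ^ S N) * gauss q (S N) (S n)
                    - q * ((1 - q ^ S N) * gauss q N n)
                    + (1 - q ^ S (S n)) * gauss q (S N) (S n)); [ring|].
      rewrite <- IH, (Cpow_S q (S n)), (Cpow_S q (S N)). ring.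
Qed.

(** Pascal's rule under the sum, with the second term reindexed: a step in [N] becomes an operator
    on the weights [u], so the two sides of the finite identity can be treated weight by weight. *)
Lemma sum_gauss_S q (u : nat -> C) N :
  sum_n (fun n => gauss q (S N) n * u n) (S N)
  = sum_n (fun n => gauss q N n * (q ^ n * u n + u (S n))) N.
Proof.
  unfold sum_n. rewrite sum_Sn_m by lia.
  rewrite <- sum_n_m_S.
  rewrite (sum_n_m_ext_loc _ (fun n => plus (gauss q N (S n) * (q ^ S n * u (S n)))
                                            (gauss q N n * u (S n))))
    by (intros k _; to_C; simpl; ring).
  rewrite sum_n_m_plus, plus_assoc.
  rewrite (sum_n_m_S (fun n => gauss q N n * (q ^ n * u n))).
  replace (gauss q (S N) 0 * u O) with (gauss q N 0 * (q ^ 0 * u O))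
    by (rewrite !gauss_0_r; simpl; ring).
  rewrite <- (sum_Sn_m (fun n => gauss q N n * (q ^ n * u n))) by lia.
  rewrite sum_n_Sm by lia.
  (* The top term lies outside the triangle and vanishes, so the range closes at [N] again. *)
  rewrite gauss_gt with (n := S N) by lia.
  replace (0 * (q ^ S N * u (S N))) with (@zero C_AbelianMonoid) by (symmetry; apply Cmult_0_l).
  rewrite plus_zero_r, <- sum_n_m_plus.
  apply sum_n_m_ext_loc. intros k _. to_C. ring.
Qed.

(** * Shifted factorials and the finite identity *)

Lemma qpoch_shift x q n : qpoch x q (S n) = (1 - x) * qpoch (x * q) q n.
Proof.
  induction n as [|n IH]; [simpl; ring|].
  change (qpoch x q (S (S n))) with (qpoch x q (S n) * (1 - x * q ^ S n)).
  rewrite IH. simpl. ring.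
Qed.

Lemma qpoch_add x q k m :
  qpoch x q (k + m) = qpoch x q k * qpoch (x * q ^ k) q m.
Proof.
  induction m as [|m IH]; [rewrite Nat.add_0_r; simpl; ring|].
  rewrite Nat.add_succ_r. simpl. rewrite IH, Cpow_add_r. ring.
Qed.

Lemma triangular_S n : (S n * (S n + 1) / 2 = n * (n + 1) / 2 + S n)%nat.
Proof.
  replace (S n * (S n + 1))%nat with (n * (n + 1) + S n * 2)%nat by lia.
  now rewrite Nat.div_add by lia.
Qed.

Lemma sum_n_mult_l_C (c : C) (u : nat -> C) N :
  sum_n (fun n => c * u n) N = c * sum_n u N.
Proof. exact (sum_n_mult_l (K := C_Ring) c u N). Qed.

(** The factor [qpoch (- b * q ^ S k) q (N - k)] stands for the quotient of (-bq;q)_N by (-bq;q)_k.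
    This keeps the induction, which passes to [a * q] and [b * q], free of division. *)
Lemma finite_identity_shifted q N a b :
  sum_n (fun n => gauss q N n *
           (qpoch (- a) q n * b ^ n * q ^ (n * (n + 1) / 2)%nat)) N
  = sum_n (fun k => gauss q N k *
           ((a * b) ^ k * q ^ (k ^ 2)%nat * qpoch (- b * q ^ S k) q (N - k))) N.
Proof.
  revert a b; induction N as [|N IH]; intros a b.
  { rewrite !sum_O. simpl. ring. }
  rewrite !sum_gauss_S.
  (* Peeling [1 + a] off [qpoch (- a) q (S n)] leaves a copy at [a * q]; the extra powers of [q]
     turn [b] into [b * q]. *)
  transitivity (sum_n (fun n => plus
     (gauss q N n * (qpoch (- a) q n * (b * q) ^ n * q ^ (n * (n + 1) / 2)%nat))
     (b * q * (1 + a) * (gauss q N n * (qpoch (- (a * q)) q n * (b * q) ^ n * q ^ (n * (n + 1) / 2)%nat)))) N).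
  { apply sum_n_ext. intros n. to_C.
    rewrite qpoch_shift, triangular_S, Cpow_add_r, !Cpow_mult_l, !Cpow_S.
    replace (- a * q) with (- (a * q)) by ring. ring. }
  rewrite sum_n_plus, sum_n_mult_l_C, !IH.
  rewrite <- sum_n_mult_l_C, <- sum_n_plus.
  apply sum_n_ext_loc. intros k Hk. to_C.
  replace (S N - k)%nat with (S (N - k)) by lia.
  replace (S N - S k)%nat with (N - k)%nat by lia.
  (* Up to the common factor (ab)^k q^(k^2) (-b q^(k+2);q)_(N-k), the summands agree because q^k (1
     + b q^(k+1)) + a b q^(2k+1) = q^k + b q (1 + a) q^(2k). *)
  rewrite qpoch_shift.
  replace (- b * q ^ S k * q) with (- (b * q) * q ^ S k) by ring.
  replace (- b * q ^ S (S k)) with (- (b * q) * q ^ S k) by (rewrite (Cpow_S q (S k)); ring).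
  replace (S k ^ 2)%nat with (k ^ 2 + k + k + 1)%nat by (simpl; lia).
  rewrite !Cpow_add_r, !Cpow_mult_l, !Cpow_S. simpl (q ^ 0). ring.
Qed.

Lemma finite_identity q N a b :
  (forall k, qpoch (- b * q) q k <> 0) ->
  sum_n (fun n => gauss q N n *
           (qpoch (- a) q n * b ^ n * q ^ (n * (n + 1) / 2)%nat)) N
  = qpoch (- b * q) q N *
    sum_n (fun k => gauss q N k *
           ((a * b) ^ k * q ^ (k ^ 2)%nat / qpoch (- b * q) q k)) N.
Proof.
  intros H. rewrite finite_identity_shifted, <- sum_n_mult_l_C.
  apply sum_n_ext_loc. intros k Hk.
  assert (E : qpoch (- b * q) q N = qpoch (- b * q) q k * qpoch (- b * q ^ S k) q (N - k)).
  { replace (- b * q ^ S k) with (- b * q * q ^ k) by (simpl; ring).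
    rewrite <- qpoch_add. f_equal. lia. }
  rewrite E. to_C. field. apply H.
Qed.

(** * Complex limits and Tannery's theorem *)

Lemma filterlim_C_iff (u : nat -> C) (l : C) :
  filterlim u eventually (locally l) <-> is_lim_seq (fun n => Cmod (u n - l)) 0%R.
Proof.
  split; intros H.
  - apply is_lim_seq_spec. intros eps.
    destruct (proj1 (filterlim_locally_ball_norm (U := C_NormedModule) u l) H eps) as [N HN].
    exists N. intros n Hn. rewrite Rminus_0_r, Rabs_pos_eq by apply Cmod_ge_0.
    exact (HN n Hn).
  - apply (filterlim_locally_ball_norm (U := C_NormedModule)). intros eps.
    apply is_lim_seq_spec in H. destruct (H eps) as [N HN].
    exists N. intros n Hn. specialize (HN n Hn).
    rewrite Rminus_0_r, Rabs_pos_eq in HN by apply Cmod_ge_0. exact HN.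
Qed.

Lemma filterlim_Cmult (u v : nat -> C) (l m : C) :
  filterlim u eventually (locally l) -> filterlim v eventually (locally m) ->
  filterlim (fun n => u n * v n) eventually (locally (l * m)).
Proof.
  intros Hu Hv. apply filterlim_C_iff in Hu, Hv. apply filterlim_C_iff.
  apply is_lim_seq_le_le with (fun _ => 0%R)
    (fun n => Cmod (u n - l) * Cmod (v n - m)
              + (Cmod l * Cmod (v n - m) + Cmod m * Cmod (u n - l)))%R.
  - intros n. split; [apply Cmod_ge_0|]. rewrite <- !Cmod_mult.
    replace (u n * v n - l * m)
      with ((u n - l) * (v n - m) + (l * (v n - m) + m * (u n - l))) by ring.
    eapply Rle_trans; [apply Cmod_triangle|]. apply Rplus_le_compat_l, Cmod_triangle.
  - apply is_lim_seq_const.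
  - replace (Finite 0) with (Finite (0 * 0 + (Cmod l * 0 + Cmod m * 0))%R)
      by (f_equal; ring).
    apply is_lim_seq_plus'; [|apply is_lim_seq_plus'];
      (apply is_lim_seq_mult'; [|assumption]); assumption || apply is_lim_seq_const.
Qed.

Lemma is_lim_seq_sum_n (e : nat -> nat -> R) K :
  (forall k, is_lim_seq (fun N => e N k) 0%R) ->
  is_lim_seq (fun N => sum_n (e N) K) 0%R.
Proof.
  intros H. induction K as [|K IH].
  - apply is_lim_seq_ext with (2 := H O). intros N. now rewrite sum_O.
  - apply is_lim_seq_ext with (fun N => sum_n (e N) K + e N (S K))%R.
    + intros N. now rewrite sum_Sn.
    + replace (Finite 0) with (Finite (0 + 0)) by (f_equal; ring).
      now apply is_lim_seq_plus'.
Qed.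

(** The truncation grows with the parameter, so the sum is cut at a fixed [K]: the head is a finite
    sum of null sequences, the tail is at most a tail of [h]. *)
Lemma tannery_zero (e : nat -> nat -> R) (h : nat -> R) :
  ex_series h ->
  (forall N k, (0 <= e N k <= h k)%R) ->
  (forall k, is_lim_seq (fun N => e N k) 0%R) ->
  is_lim_seq (fun N => sum_n (e N) N) 0%R.
Proof.
  intros [H HH] He Hlim.
  apply is_lim_seq_spec. intros eps.
  assert (HS : is_lim_seq (sum_n h) H) by exact HH.
  (* The tail of [h] is a difference of two partial sums, each within eps/4 of [H]; with eps/4 for
     the head this makes 3 eps/4. *)
  assert (e4 : (0 < eps / 4)%R) by (destruct eps; simpl; lra).
  apply is_lim_seq_spec in HS. destruct (HS (mkposreal _ e4)) as [K HK].
  pose proof (is_lim_seq_sum_n e K Hlim) as HL.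
  apply is_lim_seq_spec in HL. destruct (HL (mkposreal _ e4)) as [N0 HN0].
  simpl in HK, HN0.
  exists (S (max K N0)). intros N HN.
  assert (Hsplit : forall u : nat -> R,
    sum_n u N = (sum_n u K + sum_n_m u (S K) N)%R).
  { intros u. unfold sum_n. apply (sum_n_m_Chasles u 0 K N); lia. }
  assert (Htail : (sum_n_m (e N) (S K) N <= sum_n_m h (S K) N)%R)
    by (apply sum_n_m_le; intros k; apply He).
  assert (Hpos : (0 <= sum_n (e N) N)%R).
  { rewrite <- (Rmult_0_r (INR (S N))), <- sum_n_const.
    apply sum_n_m_le. intros k; apply He. }
  assert (H1 := HK K (le_n K)). assert (H2 := HK N ltac:(lia)).
  assert (H3 := HN0 N ltac:(lia)).
  rewrite Hsplit in H2. rewrite Rminus_0_r, Rabs_pos_eq by assumption.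
  rewrite Hsplit.
  apply Rabs_def2 in H1, H2, H3. lra.
Qed.

(** Dominated convergence for series: [tannery_zero] applies to [Cmod (f N k - g k)], with majorant
    twice [h]. *)
Lemma tannery (f : nat -> nat -> C) (g : nat -> C) (h : nat -> R) :
  ex_series h ->
  (forall N k, (Cmod (f N k) <= h k)%R) ->
  (forall k, filterlim (fun N => f N k) eventually (locally (g k))) ->
  exists S : C, is_series g S /\
    filterlim (fun N => sum_n (f N) N) eventually (locally S).
Proof.
  intros Hh Hf Hlim.
  assert (Hlim' : forall k, is_lim_seq (fun N => Cmod (f N k - g k)) 0%R)
    by (intros k; apply filterlim_C_iff, Hlim).
  (* The bound passes to the limit: otherwise the gap [Cmod (g k) - h k] is an epsilon that no
     [f N k] can meet. *)
  assert (Hg : forall k, (Cmod (g k) <= h k)%R).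
  { intros k. apply Rnot_lt_le. intros Hk.
    assert (ek : (0 < Cmod (g k) - h k)%R) by lra.
    specialize (Hlim' k). apply is_lim_seq_spec in Hlim'.
    destruct (Hlim' (mkposreal _ ek)) as [N HN]. specialize (HN N (le_n N)).
    simpl in HN. rewrite Rminus_0_r, Rabs_pos_eq in HN by apply Cmod_ge_0.
    specialize (Hf N k).
    assert (T := Cmod_triangle (f N k) (- (f N k - g k))).
    rewrite Cmod_opp in T.
    replace (f N k + - (f N k - g k)) with (g k) in T by ring. lra. }
  destruct (ex_series_le (V := C_CompleteNormedModule) g h) as [S HS].
  { exact Hg. }
  { exact Hh. }
  exists S. split; [exact HS|].
  assert (Hd : is_lim_seq (fun N => sum_n (fun k => Cmod (f N k - g k)) N) 0%R).
  { apply tannery_zero with (fun k => h k + h k)%R; trivial.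
    - now apply (ex_series_plus h h).
    - intros N k. split; [apply Cmod_ge_0|].
      assert (T := Cmod_triangle (f N k) (- g k)). rewrite Cmod_opp in T.
      specialize (Hf N k). specialize (Hg k). unfold Cminus. lra. }
  apply filterlim_C_iff.
  assert (HS' : is_lim_seq (fun N => Cmod (sum_n g N - S)) 0%R)
    by (apply filterlim_C_iff; exact HS).
  apply is_lim_seq_le_le with (fun _ => 0%R)
    (fun N => sum_n (fun k => Cmod (f N k - g k)) N + Cmod (sum_n g N - S))%R.
  - intros N. split; [apply Cmod_ge_0|].
    assert (E : sum_n (f N) N = sum_n (fun k => f N k - g k) N + sum_n g N).
    { change Cplus with (@plus C_AbelianMonoid). rewrite <- sum_n_plus.
      apply sum_n_ext. intros k. to_C. ring. }
    rewrite E.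
    replace (sum_n (fun k => f N k - g k) N + sum_n g N - S)
      with (sum_n (fun k => f N k - g k) N + (sum_n g N - S)) by ring.
    eapply Rle_trans; [apply Cmod_triangle|]. apply Rplus_le_compat_r.
    exact (norm_sum_n_m (V := C_NormedModule) (fun k => f N k - g k) 0 N).
  - apply is_lim_seq_const.
  - replace (Finite 0) with (Finite (0 + 0)) by (f_equal; ring).
    now apply is_lim_seq_plus'.
Qed.

(** Triangular exponents beat geometric growth: consecutive terms have ratio [D * r * r ^ n], which
    tends to 0. *)
Lemma ex_series_pow_triangular (D r : R) :
  (0 < D)%R -> (0 < r < 1)%R ->
  ex_series (fun n => D ^ n * r ^ (n * (n + 1) / 2))%R.
Proof.
  intros HD Hr.
  assert (Hpos : forall n, (0 < D ^ n * r ^ (n * (n + 1) / 2))%R)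
    by (intros n; apply Rmult_lt_0_compat; apply pow_lt; lra).
  apply ex_series_ext with (fun n => Rabs (D ^ n * r ^ (n * (n + 1) / 2))).
  { intros n. apply Rabs_pos_eq, Rlt_le, Hpos. }
  apply ex_series_DAlembert with 0%R; [lra| |].
  - intros n. apply Rgt_not_eq, Hpos.
  - apply is_lim_seq_ext with (fun n => (D * r) * r ^ n)%R.
    + intros n. rewrite Rabs_pos_eq by (apply Rlt_le, Rdiv_lt_0_compat; apply Hpos).
      rewrite triangular_S, pow_add. simpl. field.
      split; apply pow_nonzero; lra.
    + replace (Finite 0) with (Rbar_mult (D * r)%R 0%R) by (simpl; f_equal; ring).
      apply is_lim_seq_scal_l, is_lim_seq_geom. rewrite Rabs_pos_eq; lra.
Qed.

(** * Limits and bounds for Gaussian binomials and shifted factorials *)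

Lemma filterlim_Cpow_0 q :
  (Cmod q < 1)%R -> filterlim (fun n => q ^ n) eventually (locally (RtoC 0)).
Proof.
  intros Hq. apply filterlim_C_iff.
  apply is_lim_seq_ext with (fun n => Cmod q ^ n)%R.
  - intros n. rewrite <- Cmod_pow. f_equal. ring.
  - apply is_lim_seq_geom. rewrite Rabs_pos_eq; [assumption|apply Cmod_ge_0].
Qed.

Lemma one_minus_pow_neq_0 q n : (Cmod q < 1)%R -> 1 - q ^ S n <> 0.
Proof.
  intros Hq E.
  assert (E1 : q ^ S n = 1).
  { replace (q ^ S n) with (1 - (1 - q ^ S n)) by ring. rewrite E. ring. }
  apply (f_equal Cmod) in E1. rewrite Cmod_pow, Cmod_1 in E1.
  assert (H := pow_lt_1_compat (Cmod q) (S n) (conj (Cmod_ge_0 q) Hq) ltac:(lia)).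
  lra.
Qed.

Lemma qpoch_q_neq_0 q n : (Cmod q < 1)%R -> qpoch q q n <> 0.
Proof.
  intros Hq. induction n as [|n IH]; simpl; [apply C1_nz|].
  apply Cmult_neq_0; [assumption|]. exact (one_minus_pow_neq_0 q n Hq).
Qed.

(** Induction on [n]: [gauss_absorb] writes [gauss q (S N) (S n)] as [gauss q N n] times (1 -
    q^(N+1)) / (1 - q^(n+1)). *)
Lemma filterlim_gauss q n :
  (Cmod q < 1)%R ->
  filterlim (fun N => gauss q N n) eventually (locally (/ qpoch q q n)).
Proof.
  intros Hq. induction n as [|n IH].
  - apply filterlim_C_iff.
    apply is_lim_seq_ext with (fun _ => 0%R); [|apply is_lim_seq_const].
    intros N. rewrite gauss_0_r. simpl. rewrite <- Cmod_0. f_equal. field.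
  - apply filterlim_C_iff. apply is_lim_seq_incr_1. apply filterlim_C_iff.
    assert (Hn := one_minus_pow_neq_0 q n Hq).
    (* The factor [1 - 0 * q] is the limit of [1 - q ^ N * q], spelled as the product rule delivers
       it. *)
    replace (/ qpoch q q (S n)) with ((1 - 0 * q) * (/ qpoch q q n * / (1 - q ^ S n)))
      by (simpl; field; split; [exact Hn | now apply qpoch_q_neq_0]).
    apply filterlim_ext with (fun N => (1 - q ^ N * q) * (gauss q N n * / (1 - q ^ S n))).
    + intros N. replace (q ^ N * q) with (q ^ S N) by (simpl; ring).
      rewrite Cmult_assoc, <- gauss_absorb. field. exact Hn.
    + apply filterlim_Cmult; [|apply filterlim_Cmult; [exact IH|apply filterlim_const]].
      assert (H := filterlim_Cmult _ _ _ _ (filterlim_Cpow_0 q Hq) (filterlim_const q)).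
      apply filterlim_C_iff in H. apply filterlim_C_iff.
      apply is_lim_seq_ext with (2 := H). intros N. rewrite <- Cmod_opp. f_equal. ring.
Qed.

(** With B = 1 / (1 - |q|), Pascal's rule reproduces the bound exactly: |q| B^(n+1) + B^n = B^(n+1).
    Uniformity in [N] is what Tannery's theorem asks for. *)
Lemma Cmod_gauss_le q N n :
  (Cmod q < 1)%R -> (Cmod (gauss q N n) <= (/ (1 - Cmod q)) ^ n)%R.
Proof.
  intros Hq. assert (H0 := Cmod_ge_0 q). revert n; induction N as [|N IH]; intros [|n].
  - simpl. rewrite Cmod_1. lra.
  - cbn [gauss]. rewrite Cmod_0. apply pow_le, Rlt_le, Rinv_0_lt_compat. lra.
  - simpl. rewrite Cmod_1. lra.
  - cbn [gauss]. eapply Rle_trans; [apply Cmod_triangle|].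
    rewrite Cmod_mult, Cmod_pow.
    set (B := (/ (1 - Cmod q))%R) in *.
    assert (HB : (0 < B ^ n)%R) by (apply pow_lt, Rinv_0_lt_compat; lra).
    apply Rle_trans with (Cmod q * B ^ S n + B ^ n)%R.
    + apply Rplus_le_compat; [|apply IH].
      apply Rmult_le_compat; [apply pow_le; lra|apply Cmod_ge_0| |apply IH].
      rewrite <- (Rmult_1_r (Cmod q)) at 2. simpl. apply Rmult_le_compat_l; [lra|].
      rewrite <- (pow1 n). apply pow_incr. lra.
    + assert (E : ((1 - Cmod q) * B = 1)%R) by (unfold B; field; lra).
      simpl.
      replace (Cmod q * (B * B ^ n) + B ^ n)%R
        with (B * B ^ n + (1 - (1 - Cmod q) * B) * B ^ n)%R by ring.
      rewrite E. lra.
Qed.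

Lemma Cmod_qpoch_le x q n :
  (Cmod q < 1)%R -> (Cmod (qpoch x q n) <= (1 + Cmod x) ^ n)%R.
Proof.
  intros Hq. assert (H0 := Cmod_ge_0 q). assert (Hx := Cmod_ge_0 x).
  induction n as [|n IH]; simpl; [rewrite Cmod_1; lra|].
  rewrite Cmod_mult, Rmult_comm.
  apply Rmult_le_compat; [apply Cmod_ge_0|apply Cmod_ge_0| |exact IH].
  eapply Rle_trans; [apply Cmod_triangle|].
  rewrite Cmod_1, Cmod_opp, Cmod_mult, Cmod_pow. apply Rplus_le_compat_l.
  rewrite <- (Rmult_1_r (Cmod x)) at 2. apply Rmult_le_compat_l; [lra|].
  rewrite <- (pow1 n). apply pow_incr. lra.
Qed.

(** The factors of (x;q)_n tend to 1 and none vanishes, so they are bounded away from 0. *)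
Lemma Cmod_inv_qpoch_le x q :
  (Cmod q < 1)%R -> (forall n, 1 - x * q ^ n <> 0) ->
  exists M, (0 < M)%R /\ forall n, (Cmod (/ qpoch x q n) <= M ^ n)%R.
Proof.
  intros Hq Hx.
  assert (Hne : forall n, qpoch x q n <> 0).
  { induction n; simpl; [apply C1_nz|now apply Cmult_neq_0]. }
  assert (H1 : is_lim_seq (fun n => Cmod (1 - x * q ^ n)) 1%R).
  { assert (H := filterlim_Cmult _ _ _ _ (filterlim_const x) (filterlim_Cpow_0 q Hq)).
    apply filterlim_C_iff in H.
    apply is_lim_seq_le_le with (fun n => 1 - Cmod (x * q ^ n - x * 0))%R
      (fun n => 1 + Cmod (x * q ^ n - x * 0))%R.
    - intros n. replace (x * q ^ n - x * 0) with (x * q ^ n) by ring.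
      assert (T1 := Cmod_triangle 1 (- (x * q ^ n))).
      assert (T2 := Cmod_triangle (1 - x * q ^ n) (x * q ^ n)).
      replace (1 - x * q ^ n + x * q ^ n) with (RtoC 1) in T2 by ring.
      rewrite Cmod_opp, Cmod_1 in T1. rewrite Cmod_1 in T2. unfold Cminus in *. lra.
    - replace (Finite 1) with (Finite (1 - 0)) by (f_equal; ring).
      apply is_lim_seq_minus'; [apply is_lim_seq_const|exact H].
    - replace (Finite 1) with (Finite (1 + 0)) by (f_equal; ring).
      apply is_lim_seq_plus'; [apply is_lim_seq_const|exact H]. }
  apply is_lim_seq_inv in H1; [|intros E; injection E; lra].
  destruct (filterlim_bounded (V := R_NormedModule) _
    (ex_intro (fun l : R => filterlim _ eventually (locally l)) (/ 1)%R H1)) as [M HM].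
  assert (HM' : forall n, (Cmod (/ (1 - x * q ^ n)) <= M)%R).
  { intros n. rewrite Cmod_inv by apply Hx.
    eapply Rle_trans; [apply Rle_abs|exact (HM n)]. }
  assert (HMpos : (0 < M)%R).
  { eapply Rlt_le_trans; [|apply (HM' O)].
    rewrite Cmod_inv by apply Hx. apply Rinv_0_lt_compat, Cmod_gt_0, Hx. }
  exists M. split; [exact HMpos|].
  induction n as [|n IH]; simpl.
  - replace (/ 1) with (RtoC 1) by field. rewrite Cmod_1. lra.
  - rewrite Rmult_comm.
    replace (/ (qpoch x q n * (1 - x * q ^ n))) with (/ qpoch x q n * / (1 - x * q ^ n))
      by (field; split; [apply Hx|apply Hne]).
    rewrite Cmod_mult.
    apply Rmult_le_compat; auto using Cmod_ge_0.
Qed.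

(** * Passage to the limit on both sides *)

Lemma gauss_series q (u : nat -> C) (D : R) :
  (Cmod q < 1)%R -> (0 < D)%R ->
  (forall n, (Cmod (u n) <= D ^ n * Cmod q ^ (n * (n + 1) / 2))%R) ->
  exists S : C, is_series (fun n => u n / qpoch q q n) S /\
    filterlim (fun N => sum_n (fun n => gauss q N n * u n) N) eventually (locally S).
Proof.
  intros Hq HD Hu. assert (H0 := Cmod_ge_0 q).
  (* [Cmod q] may be 0, while the ratio test needs nonzero terms; [r] is positive, still below 1,
     and at least [Cmod q]. *)
  set (r := ((Cmod q + 1) / 2)%R). assert (Hr : (0 < r < 1)%R) by (unfold r; lra).
  assert (HB : (0 < / (1 - Cmod q))%R) by (apply Rinv_0_lt_compat; lra).
  (* The bound on [gauss q N n] is geometric in [n] and joins [D]. *)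
  apply tannery with
    (fun n => ((/ (1 - Cmod q)) * D) ^ n * r ^ (n * (n + 1) / 2))%R.
  - apply ex_series_pow_triangular; [now apply Rmult_lt_0_compat|exact Hr].
  - intros N k. rewrite Cmod_mult, Rpow_mult_distr, Rmult_assoc.
    apply Rmult_le_compat; auto using Cmod_ge_0, Cmod_gauss_le.
    eapply Rle_trans; [apply Hu|]. apply Rmult_le_compat_l; [apply pow_le; lra|].
    apply pow_incr. unfold r; lra.
  - intros k. unfold Cdiv. rewrite Cmult_comm.
    apply filterlim_Cmult; [now apply filterlim_gauss|apply filterlim_const].
Qed.

Lemma triangular_le_sqr n : (n * (n + 1) / 2 <= n ^ 2)%nat.
Proof.
  replace (n ^ 2)%nat with (n * n)%nat by (simpl; lia).
  apply Nat.Div0.div_le_upper_bound. nia.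
Qed.

Lemma pow_le_pow_of_le (x : R) m n : (0 <= x <= 1)%R -> (m <= n)%nat -> (x ^ n <= x ^ m)%R.
Proof.
  intros Hx Hmn. replace n with (m + (n - m))%nat by lia. rewrite pow_add.
  rewrite <- (Rmult_1_r (x ^ m)) at 2.
  apply Rmult_le_compat_l; [apply pow_le; lra|].
  rewrite <- (pow1 (n - m)). apply pow_incr. lra.
Qed.

Theorem theorem2 (a b q : C)
  (hq : (Cmod q < 1)%R)
  (hb : forall N : nat, (1 <= N)%nat -> 1 + b * q ^ N <> 0) :
  exists L P S : C,
    is_series
      (fun n : nat =>
         qpoch (- a) q n * b ^ n * q ^ (n * (n + 1) / 2)%nat / qpoch q q n) L /\
    is_qpoch_inf (- b * q) q P /\
    is_series
      (fun n : nat =>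
         (a * b) ^ n * q ^ (n ^ 2)%nat / (qpoch q q n * qpoch (- b * q) q n)) S /\
    L = P * S.
Proof.
  assert (Hfac : forall n, 1 - - b * q * q ^ n <> 0).
  { intros n. replace (1 - - b * q * q ^ n) with (1 + b * q ^ S n) by (simpl; ring).
    apply hb. lia. }
  assert (Hne : forall n, qpoch (- b * q) q n <> 0).
  { induction n; simpl; [apply C1_nz|now apply Cmult_neq_0]. }
  assert (Hleft : forall c, exists L : C,
    is_series (fun n => qpoch (- c) q n * b ^ n * q ^ (n * (n + 1) / 2)%nat / qpoch q q n) L /\
    filterlim (fun N => sum_n (fun n => gauss q N n *
      (qpoch (- c) q n * b ^ n * q ^ (n * (n + 1) / 2)%nat)) N) eventually (locally L)).
  { intros c. assert (Hb := Cmod_ge_0 b). assert (Hc := Cmod_ge_0 c).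
    apply gauss_series with ((1 + Cmod c) * (1 + Cmod b))%R; [exact hq| |].
    - apply Rmult_lt_0_compat; lra.
    - intros n. rewrite !Cmod_mult, !Cmod_pow, Rpow_mult_distr.
      apply Rmult_le_compat_r; [apply pow_le, Cmod_ge_0|].
      apply Rmult_le_compat; [apply Cmod_ge_0|apply pow_le; lra| |apply pow_incr; lra].
      rewrite <- (Cmod_opp c). now apply Cmod_qpoch_le. }
  destruct (Hleft a) as [L [HL HL']].
  (* At a = 0 the finite identity expands (-bq;q)_N itself, which gives its convergence. *)
  destruct (Hleft 0) as [P [_ HP]].
  assert (HP' : is_qpoch_inf (- b * q) q P).
  { unfold is_qpoch_inf. apply filterlim_ext with (2 := HP). intros N.
    rewrite finite_identity by assumption.
    (* Only index 0 survives, since [0 * b] to a positive power is 0. *)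
    rewrite (sum_n_ext _ (fun k => match k with O => RtoC 1 | S _ => RtoC 0 end)).
    - assert (E : forall M, sum_n (fun k => match k with O => RtoC 1 | S _ => RtoC 0 end) M = RtoC 1).
      { induction M as [|M IH]; [now rewrite sum_O|].
        rewrite sum_Sn, IH. apply Cplus_0_r. }
      rewrite E. apply Cmult_1_r.
    - intros [|k]; [rewrite gauss_0_r; simpl; to_C; field|].
      rewrite Cpow_mult_l, (Cpow_S 0). to_C. field. apply Hne. }
  destruct (Cmod_inv_qpoch_le (- b * q) q hq Hfac) as [M [HM HMle]].
  (* Here [M] bounds the growth of the inverse factorials, and [1 +] keeps the constant positive
     even if [a * b] is 0. The exponent n^2 dominates the triangular one. *)
  destruct (gauss_series q
    (fun k => (a * b) ^ k * q ^ (k ^ 2)%nat / qpoch (- b * q) q k)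
    ((1 + Cmod (a * b)) * M)) as [S [HS HS']]; [exact hq| | |].
  { assert (H := Cmod_ge_0 (a * b)). apply Rmult_lt_0_compat; lra. }
  { intros n. assert (H := Cmod_ge_0 (a * b)). assert (H0 := Cmod_ge_0 q).
    unfold Cdiv. rewrite !(Cmod_mult _ (/ _)), (Cmod_mult (_ ^ _)), !Cmod_pow, Rpow_mult_distr.
    rewrite (Rmult_assoc ((1 + Cmod (a * b)) ^ n)), (Rmult_comm (M ^ n)), <- Rmult_assoc.
    apply Rmult_le_compat; [|apply Cmod_ge_0| |apply HMle].
    - apply Rmult_le_pos; apply pow_le; assumption.
    - apply Rmult_le_compat; try (apply pow_le; assumption).
      + apply pow_incr; lra.
      + apply pow_le_pow_of_le; [lra|apply triangular_le_sqr]. }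
  exists L, P, S. split; [exact HL|]. split; [exact HP'|]. split.
  - apply is_series_ext with (2 := HS). intros n. to_C. field.
    split; [apply Hne | now apply qpoch_q_neq_0].
  (* By the finite identity, [L] and [P * S] are limits of the same sequence. *)
  - apply (filterlim_locally_unique (V := C_NormedModule) (F := eventually)
      (fun N => sum_n (fun n => gauss q N n *
      (qpoch (- a) q n * b ^ n * q ^ (n * (n + 1) / 2)%nat)) N)); [exact HL'|].
    apply filterlim_ext with
      (2 := filterlim_Cmult _ _ _ _ HP' HS').
    intros N. symmetry. now apply finite_identity.
Qed.
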